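(* Let $n=2(k+1)$ for an integer $k\ge 2$, and let $\sigma_n$ be the multiset consisting of $k$ copies of $1$, one copy of $\frac{-1}{2k+1}$, and $k+1$ copies of $\frac{1-2k}{2k+1}$. Then $\sum_{\lambda\in\sigma_n}\lambda=0$ (counted with multiplicity), and $\sigma_n$ is not realizable.
   Context: A multiset $\sigma=\{\lambda_1,\dots,\lambda_n\}$ of complex numbers is realizable if there exists an $n\times n$ matrix with all entries real and nonnegative whose eigenvalues, counted with algebraic multiplicity, are exactly $\lambda_1,\dots,\lambda_n$. *)

(* Defs.v *)
From HB Require Import structures.
From mathcomp Require Import all_boot all_order all_algebra.
From mathcomp Require Import reals.
From mathcomp Require Import complex.
Set Implicit Arguments. Unset Strict Implicit. Unset Printing Implicit Defensive.
Import Order.TTheory GRing.Theory Num.Theory.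
Local Open Scope ring_scope.

(* A finite multiset of complex numbers is represented by a sequence (order
   irrelevant).  [realizable s] : there is a size(s) x size(s) matrix with real
   nonnegative entries whose eigenvalues, counted with algebraic multiplicity,
   are exactly the elements of s, i.e. whose characteristic polynomial (viewed
   over the complex numbers R[i]) splits as \prod_(l <- s) ('X - l). *)
Definition realizable (R : realType) (s : seq R[i]) : Prop :=
  exists A : 'M[R]_(size s),
    (forall i j, 0 <= A i j) /\
    map_poly (fun x : R => x%:C%C) (char_poly A) = \prod_(l <- s) ('X - l%:P).

Definition sigma (R : realType) (k : nat) : seq R[i] :=
  nseq k 1 ++ [:: (- 1 / (2 * k%:R + 1))%:C%C]
           ++ nseq k.+1 ((1 - 2 * k%:R) / (2 * k%:R + 1))%:C%C.

(* Main.v *)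
Require Import Defs.
From HB Require Import structures.
From mathcomp Require Import all_boot all_order all_algebra.
From mathcomp Require Import reals.
From mathcomp Require Import complex.
From mathcomp Require Import perm spectral ring lra zify.
Import Order.TTheory GRing.Theory Num.Theory.
Local Open Scope ring_scope.

(** A realizing matrix [A] has trace 0, hence zero diagonal, and so has each of
    its irreducible diagonal blocks.  An irreducible block has the eigenvalue 1
    at most once (Perron-Frobenius).  If exactly once, its other eigenvalues sum
    to -1, so they cannot all equal [(1 - 2k)/(2k+1)], since [(2k+1)/(2k-1)] is
    not an integer; the block must then use the eigenvalue [-1/(2k+1)].  This is
    available only once, whereas 1 occurs [k >= 2] times.

    Simplicity of 1 has a direct proof here, because the other eigenvalues are
    nonpositive: writing the characteristic polynomial as [(X - 1)^c h], the
    matrix [H = h(A)] is nonnegative.  If [G = (A - 1)^d H] is the last nonzero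
    matrix of this form, the growth of [A^M H] shows [G >= 0]; since
    [A G = G = G A], irreducibility gives [G > 0].  For [d > 0] one would have
    [G^2 = 0], so [d = 0] and [H^2 = h(1) H] with [H > 0].  Such a matrix has
    rank one and trace [h(1)], while its trace is [c h(1)] by triangularization. *)

(** * Traces of matrix polynomials from the spectrum *)

Lemma horner_mx_trig {R : comNzRingType} {n : nat} (A : 'M[R]_n.+1) (p : {poly R}) :
  is_trig_mx A ->
  is_trig_mx (horner_mx A p) /\ forall i, horner_mx A p i i = p.[A i i].
Proof.
move=> /is_trig_mxP tA; elim/poly_ind: p => [|p c [/is_trig_mxP tp dp]].
  by rewrite rmorph0; split=> [|i]; [exact: mx0_is_trig | rewrite mxE horner0].
rewrite rmorphD rmorphM /= horner_mx_X horner_mx_C; split.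
  apply/is_trig_mxP=> i j ij; rewrite !mxE big1 => [|k _].
    by rewrite -val_eqE ltn_eqF // addr0.
  case: (ltnP i k) => ik; first by rewrite tp ?mul0r.
  by rewrite (tA k j) ?mulr0 // (leq_ltn_trans ik).
move=> i; rewrite !mxE eqxx !hornerE (bigD1 i) //= dp big1 ?addr0 // => k ki.
case: (ltnP i k) => ik; first by rewrite tp ?mul0r.
by rewrite tA ?mulr0 // ltn_neqAle ik andbT.
Qed.

Lemma char_poly_uconj {F : fieldType} {n : nat} (P A : 'M[F]_n) :
  P \in unitmx -> char_poly (P *m A *m invmx P) = char_poly A.
Proof.
move=> uP; rewrite /char_poly.
have -> : char_poly_mx (P *m A *m invmx P) =
    map_mx polyC P *m char_poly_mx A *m map_mx polyC (invmx P).
  rewrite /char_poly_mx mulmxBr mulmxBl !map_mxM; congr (_ - _).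
  by rewrite scalar_mxC -mulmxA -map_mxM mulmxV // map_mx1 mulmx1.
by rewrite !det_mulmx mulrAC -det_mulmx -map_mxM mulmxV // map_mx1 det1 mul1r.
Qed.

(** By Schur triangularization: conjugation preserves trace and characteristic polynomial, and the
    diagonal of the triangular form is [s] up to order. *)
Lemma mxtrace_horner_closed {C : numClosedFieldType} {n : nat} (A : 'M[C]_n.+1)
    (s : seq C) (p : {poly C}) :
  char_poly A = \prod_(x <- s) ('X - x%:P) ->
  \tr (horner_mx A p) = \sum_(x <- s) p.[x].
Proof.
move=> chA; have [|P uP /= /andP[tA _]] := @cotrigonalization C _ [:: A].
  by move=> B D; rewrite !inE => /eqP-> /eqP->.
have {}uP := unitarymx_unit uP; move: tA; rewrite /mxred.similar_to mxred.conjumx // => tA.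
have [_ dT] := horner_mx_trig _ p tA; move/char_poly_trig: tA.
rewrite char_poly_uconj // chA => st.
have /prod_XsubC_eq sE : \prod_(x <- s) ('X - x%:P) =
   \prod_(x <- [seq (P *m A *m invmx P) i i | i <- enum 'I_n.+1]) ('X - x%:P).
  by rewrite st big_map big_enum.
rewrite (perm_big _ sE) big_map big_enum /=.
transitivity (\tr (horner_mx (P *m A *m invmx P) p)).
  by rewrite horner_mx_uconj // mxtrace_mulC mulmxA mulVmx // mul1mx.
by apply: eq_bigr => i _; rewrite dT.
Qed.

Lemma mxtrace_horner {R : rcfType} {n : nat} (A : 'M[R]_n.+1)
    (s : seq R) (p : {poly R}) :
  char_poly A = \prod_(x <- s) ('X - x%:P) ->
  \tr (horner_mx A p) = \sum_(x <- s) p.[x].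
Proof.
move=> chA; apply: (fmorph_inj (real_complex R)).
rewrite -trace_map_mx map_horner_mx rmorph_sum.
rewrite (@mxtrace_horner_closed _ _ _ [seq real_complex R x | x <- s]).
  by rewrite big_map; apply: eq_bigr => x _; rewrite horner_map.
rewrite -map_char_poly chA rmorph_prod big_map.
by apply: eq_bigr => x _; rewrite /= rmorphB /= map_polyX map_polyC.
Qed.

(** * Reindexing and block triangular matrices *)

Lemma det_mxsub_bij {R : comNzRingType} {m n : nat} (f : 'I_m -> 'I_n) (A : 'M[R]_n) :
  bijective f -> \det (mxsub f f A) = \det A.
Proof.
move=> bf; have mn : m = n by rewrite -(card_ord m) (bij_eq_card bf) card_ord.
case: _ / mn f A bf => f A /bij_inj injf.
have -> : mxsub f f A = row_perm (perm injf) (col_perm (perm injf) A).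
  by apply/matrixP=> i j; rewrite !mxE !permE.
rewrite row_permE col_permE !det_mulmx !det_perm.
by rewrite mulrCA odd_permV -signr_addb addbb mulr1.
Qed.

Lemma char_poly_mxsub_bij {R : comNzRingType} {m n : nat} (f : 'I_m -> 'I_n)
    (A : 'M[R]_n) :
  bijective f -> char_poly (mxsub f f A) = char_poly A.
Proof.
move=> bf; rewrite /char_poly -[RHS](det_mxsub_bij _ _ bf); congr (\det _).
by apply/matrixP=> i j; rewrite !mxE (inj_eq (bij_inj bf)).
Qed.

Definition principal_mx {R : Type} {n : nat} (S : {set 'I_n}) (A : 'M[R]_n) : 'M[R]_#|S| :=
  mxsub (@enum_val _ (mem S)) (@enum_val _ (mem S)) A.

(** Listing the indices of [S] first makes [A] block lower triangular. *)
Lemma char_poly_reducible {R : comNzRingType} {n : nat} (A : 'M[R]_n) (S : {set 'I_n}) :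
  (forall i j, i \in S -> j \notin S -> A i j = 0) ->
  char_poly A = char_poly (principal_mx S A) * char_poly (principal_mx (~: S) A).
Proof.
move=> A0.
pose f (i : 'I_(#|S| + #|~: S|)) : 'I_n :=
  match split i with inl j => enum_val j | inr j => enum_val j end.
have fl j : f (lshift _ j) = enum_val j.
  by rewrite /f; have := unsplitK (inl _ j : 'I_#|S| + 'I_#|~: S|) => /= ->.
have fr j : f (rshift _ j) = enum_val j.
  by rewrite /f; have := unsplitK (inr _ j : 'I_#|S| + 'I_#|~: S|) => /= ->.
have enumC j : @enum_val _ (mem (~: S)) j \notin S.
  by have := enum_valP j; rewrite inE.
have injf : injective f.
  move=> i j; case: (split_ordP i) => {}i ->; case: (split_ordP j) => {}j ->;
    rewrite ?fl ?fr.
  - by move/enum_val_inj->.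
  - by move=> ij; have := enumC j; rewrite -ij enum_valP.
  - by move=> ij; have := enumC i; rewrite ij enum_valP.
  - by move/enum_val_inj->.
have bf : bijective f.
  by apply: (inj_card_bij injf); rewrite !card_ord cardsC card_ord.
rewrite -(char_poly_mxsub_bij _ _ bf) -[mxsub f f A]submxK.
have -> : ursubmx (mxsub f f A) = 0.
  apply/matrixP=> i j; rewrite !mxE fl fr; apply: A0; [exact: enum_valP|exact: enumC].
rewrite /char_poly /char_poly_mx scalar_mx_block map_block_mx.
rewrite opp_block_mx add_block_mx map_mx0 oppr0 add0r.
rewrite det_lblock; congr (_ * _); congr (\det _).
all: by apply/matrixP=> i j; rewrite !mxE ?fl ?fr.
Qed.

(** * Growth of binomial coefficients *)

(** Passing from [j] to [j.+1 <= d] multiplies the coefficient by [(N - j) / (j + 1)], which is at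
    least [K]. *)
Lemma mul_bin_leq (K d i N : nat) :
  (0 < K)%N -> (i < d)%N -> (K * d + d <= N)%N -> (K * 'C(N, i) <= 'C(N, d))%N.
Proof.
move=> K0 id dN.
have step j : (j < d)%N -> (K * 'C(N, j) <= 'C(N, j.+1))%N.
  move=> jd; rewrite -(leq_pmul2l (ltn0Sn j)) mul_bin_left mulnA leq_mul2r.
  by apply/orP; right; nia.
elim: d i id {dN} step => // d IH i; rewrite ltnS leq_eqVlt => /predU1P[->|id] step.
  exact: step.
apply: leq_trans (IH i id _) _ => [j jd|]; first by apply: step; rewrite ltnS ltnW.
by apply: leq_trans (step d _); rewrite ?leq_pmull.
Qed.

Lemma binomial_sum_lead_ge0 {R : archiRealFieldType} (d : nat) (g : nat -> R) :
  (forall N, 0 <= \sum_(i < d.+1) 'C(N, i)%:R * g i) -> 0 <= g d.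
Proof.
move=> g0; rewrite leNgt; apply/negP=> gd.
pose M := \sum_(i < d) `|g i|.
have M0 : 0 <= M by apply: sumr_ge0.
(* [K] is so large that the term of index [d], if negative, outweighs all the others together at
   [N]. *)
pose K := (Num.truncn (M / - g d)).+1.
have KM : M < K%:R * - g d.
  by rewrite -ltr_pdivrMr ?oppr_gt0 //; apply: truncnS_gt.
pose N := (K * d + d)%N.
have C0 : (0 : R) < 'C(N, d)%:R by rewrite ltr0n bin_gt0 leq_addl.
have : K%:R * \sum_(i < d.+1) 'C(N, i)%:R * g i <= 'C(N, d)%:R * (M + K%:R * g d).
  rewrite big_ord_recr /= !mulrDr (mulrCA K%:R) lerD2r !mulr_sumr.
  apply: ler_sum => i _; rewrite mulrA -natrM.
  apply: le_trans (ler_norm _) _; rewrite normrM ger0_norm ?ler0n //.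
  by rewrite ler_wpM2r // ler_nat mul_bin_leq.
rewrite leNgt => /negP; apply; apply: (@lt_le_trans _ _ 0).
  by rewrite pmulr_rlt0 //; lra.
by rewrite mulr_ge0 ?ler0n.
Qed.

(** * Nonnegative and irreducible matrices *)

Lemma mulmx_ge0 {R : numDomainType} {m n p : nat} (A : 'M[R]_(m, n)) (B : 'M[R]_(n, p)) :
  (forall i j, 0 <= A i j) -> (forall i j, 0 <= B i j) ->
  forall i j, 0 <= (A *m B) i j.
Proof. by move=> A0 B0 i j; rewrite mxE sumr_ge0 // => k _; rewrite mulr_ge0. Qed.

Lemma horner_mx_prod_ge0 {R : numDomainType} {n : nat} (A : 'M[R]_n.+1) (t : seq R) :
  (forall i j, 0 <= A i j) -> all (fun x => x <= 0) t ->
  forall i j, 0 <= horner_mx A (\prod_(x <- t) ('X - x%:P)) i j.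
Proof.
move=> A0; elim: t => [|x t IH] /= => [_ i j|/andP[x0 /IH t0]].
  by rewrite big_nil rmorph1 mxE ler0n.
rewrite big_cons rmorphM; apply: mulmx_ge0 => // i j.
rewrite rmorphB /= horner_mx_X horner_mx_C !mxE addr_ge0 // oppr_ge0.
by rewrite mulrn_wle0.
Qed.

(** Strong connectivity of the digraph of nonzero entries; vacuous in dimension at most 1. *)
Definition irreducible_mx {R : nzRingType} {n : nat} (A : 'M[R]_n) : Prop :=
  forall S : {set 'I_n}, S != set0 -> S != setT ->
    exists i j, [/\ i \in S, j \notin S & A i j != 0].

(** In [A *m G = G] a zero of [G] is a sum of nonnegative terms, so no nonzero entry of [A] leads
    from the zero set of a column to its complement: the column is all zero or has no zero.
    [G *m A = G] gives the same for rows. *)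
Lemma irreducible_fixed_gt0 {R : numDomainType} {n : nat} (A G : 'M[R]_n) :
  irreducible_mx A -> (forall i j, 0 <= A i j) -> (forall i j, 0 <= G i j) ->
  G != 0 -> A *m G = G -> G *m A = G -> forall i j, 0 < G i j.
Proof.
move=> irrA A0 G0 Gn0 AG GA.
have colG i0 j i : G i0 j != 0 -> G i j != 0.
  move=> G1; pose S := [set k | G k j == 0].
  have [S0|Sn0] := eqVneq S set0.
    by have := in_set0 i; rewrite -S0 inE => ->.
  have [ST|SnT] := eqVneq S setT.
    by have := in_setT i0; rewrite -ST inE (negPf G1).
  have [a [b []]] := irrA S Sn0 SnT; rewrite !inE => /eqP Ga Gb Aab.
  move/matrixP/(_ a j): AG; rewrite mxE Ga => /eqP.
  rewrite psumr_eq0 => [/allP/(_ b)|k _]; last exact: mulr_ge0.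
  by rewrite mem_index_enum mulf_eq0 (negPf Aab) (negPf Gb) => /(_ isT).
have rowG i j0 j : G i j0 != 0 -> G i j != 0.
  move=> G1; pose S := [set k | G i k != 0].
  have [S0|Sn0] := eqVneq S set0.
    by have := in_set0 j0; rewrite -S0 inE G1.
  have [ST|SnT] := eqVneq S setT.
    by have := in_setT j; rewrite -ST inE.
  have [a [b []]] := irrA S Sn0 SnT; rewrite !inE negbK => Ga /eqP Gb Aab.
  move/matrixP/(_ i b): GA; rewrite mxE Gb => /eqP.
  rewrite psumr_eq0 => [/allP/(_ a)|k _]; last exact: mulr_ge0.
  by rewrite mem_index_enum mulf_eq0 (negPf Aab) (negPf Ga) => /(_ isT).
have [i0 [j0 Gij]] : exists i j, G i j != 0.
  have /matrix0Pn[i [j]] := Gn0; by exists i, j.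
by move=> i j; rewrite lt0r G0 andbT; apply: (rowG i j0); apply: (colG i0).
Qed.

Lemma mxtrace_pos_quasi_idempotent {R : realFieldType} {n : nat} (H : 'M[R]_n.+1) (eta : R) :
  (forall i j, 0 < H i j) -> H *m H = eta *: H -> \tr H = eta.
Proof.
move=> H0 HH.
(* Subtracting from column [j] the largest multiple of column [0] that keeps it
   nonnegative gives an eigenvector with a zero entry; as [H > 0], it vanishes. *)
have prop j : exists t, forall i, H i j = t * H i 0.
  pose r i := H i j / H i 0.
  pose i0 := [arg min_(i < (0 : 'I_n.+1)) r i]%O.
  have ri0 i : r i0 <= r i.
    by rewrite /i0; case: Order.TotalTheory.arg_minP => // k _; apply.
  pose x i := H i j - r i0 * H i 0.
  have x0 i : 0 <= x i.
    by rewrite /x subr_ge0 -ler_pdivlMr // ri0.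
  have xi0 : x i0 = 0 by rewrite /x /r divfK ?subrr // gt_eqF.
  have Hx : \sum_k H i0 k * x k = 0.
    transitivity (eta * x i0); last by rewrite xi0 mulr0.
    have e l : \sum_k H i0 k * H k l = eta * H i0 l.
      by move/matrixP/(_ i0 l): HH; rewrite !mxE.
    rewrite /x mulrBr (mulrCA eta) -!e mulr_sumr -sumrB.
    by apply: eq_bigr => k _; rewrite mulrBr (mulrCA (r i0)).
  exists (r i0) => i; apply/eqP; rewrite -subr_eq0.
  move/eqP: Hx; rewrite psumr_eq0 => [/allP/(_ i)|k _].
    by rewrite mem_index_enum mulf_eq0 gt_eqF //= => /(_ isT).
  by rewrite mulr_ge0 // ltW.
(* As all columns are multiples of column 0, [\tr H * H 0 0] equals [(H *m H) 0 0]. *)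
apply: (@mulIf _ (H 0 0)); first by rewrite gt_eqF.
transitivity ((H *m H) 0 0); last by rewrite HH mxE.
rewrite mxE mulr_suml; apply: eq_bigr => k _.
by have [t tE] := prop k; rewrite !tE mulrAC.
Qed.

Lemma irreducible_mult_le1 {R : realType} {n : nat} (A : 'M[R]_n.+1) (c : nat) (t : seq R) :
  irreducible_mx A -> (forall i j, 0 <= A i j) -> all (fun x => x <= 0) t ->
  char_poly A = \prod_(x <- nseq c 1 ++ t) ('X - x%:P) -> (c <= 1)%N.
Proof.
move=> irrA A0 t0 chA; pose h := \prod_(x <- t) ('X - x%:P).
pose H := horner_mx A h; pose N := A - 1.
have H0 : forall i j, 0 <= H i j by exact: horner_mx_prod_ge0.
have h1 : 0 < h.[1].
  rewrite horner_prod big_seq; apply: prodr_gt0 => x xt.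
  by rewrite !hornerE; have := allP t0 x xt; lra.
have trH : \tr H = c%:R * h.[1].
  rewrite (mxtrace_horner _ _ _ chA) big_cat /= addrC big_seq big1 ?add0r => [|x xt].
    by rewrite big_nseq iter_addr_0 mulr_natl.
  by apply/rootP; rewrite root_prod_XsubC.
have hN p : (horner_mx A p) * N = N * horner_mx A p.
  rewrite /N -[A in A - 1](horner_mx_X A) -(rmorph1 (horner_mx A)) -rmorphB.
  exact: comm_horner_mx2.
have NcH : N ^+ c * H = 0.
  rewrite -(Cayley_Hamilton A) chA big_cat rmorphM; congr (_ * _) => /=.
  by rewrite big_nseq iter_mulr_1 rmorphXn rmorphB /= horner_mx_X rmorph1.
have exd : exists d, N ^+ d * H == 0 by exists c; apply/eqP.
case: (ex_minnP exd) => d /eqP dH dmin.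
case: d dH dmin => [|d] dH dmin.
  (* Here [H] itself vanishes, so its trace [c * h(1)] does too and [c = 0]. *)
  move/eqP: trH; rewrite -[H]mul1r dH mxtrace0 eq_sym mulf_eq0 pnatr_eq0.
  by rewrite (gt_eqF h1) orbF => /eqP->.
pose G := N ^+ d * H.
have NG : N * G = 0 by rewrite mulrA -exprS.
have GN : G * N = 0 by rewrite /G -mulrA hN -/H mulrA -exprSr.
have Gn0 : G != 0 by apply/negP=> /dmin; rewrite ltnn.
have AG : A *m G = G by apply/eqP; rewrite -subr_eq0 -{2}[G]mul1mx -mulmxBl; apply/eqP.
have GA : G *m A = G by apply/eqP; rewrite -subr_eq0 -{2}[G]mulmx1 -mulmxBr; apply/eqP.
(* [A ^+ M * H] is nonnegative and is a polynomial in [M] of leading term ['C(M, d) * G]. *)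
have G0 i j : 0 <= G i j.
  apply: (@binomial_sum_lead_ge0 R d (fun m => (N ^+ m * H) i j)) => M.
  have AM : A ^+ M * H = \sum_(m < d.+1) (N ^+ m * H) *+ 'C(M, m).
    (* Pads both sums with zero terms to a common length: ['C(M, m)] vanishes for [m > M], and
       [N ^+ m * H] for [m > d]. *)
    have trunc a (F : nat -> 'M[R]_n.+1) : (a <= M.+1 + d.+1)%N ->
        (forall m, (a <= m)%N -> F m = 0) ->
        \sum_(m < a) F m = \sum_(m < M.+1 + d.+1) F m.
      move=> ale F0; rewrite (big_ord_widen _ F ale) big_mkcond.
      by apply: eq_bigr => m _; case: ltnP => // /F0.
    have -> : A = N + 1 by rewrite subrK.
    rewrite exprD1n mulr_suml.
    rewrite (trunc _ (fun m => N ^+ m *+ 'C(M, m) * H)) ?leq_addr => [|//|m Mm]; last first.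
      by rewrite bin_small // mulr0n mul0r.
    rewrite (trunc _ (fun m => (N ^+ m * H) *+ 'C(M, m))) ?leq_addl => [|//|m dm]; last first.
      by rewrite -(subnK dm) exprD -mulrA dH mulr0 mul0rn.
    by apply: eq_bigr => m _; rewrite mulrnAl.
  have : 0 <= (A ^+ M * H) i j.
    elim: M {AM} i j => [|M IH] i j; first by rewrite mul1r.
    by rewrite exprS -mulrA; apply: mulmx_ge0.
  rewrite AM summxE; congr (_ <= _); apply: eq_bigr => m _.
  by rewrite mulmxnE mulr_natl.
have Gpos := irreducible_fixed_gt0 _ _ irrA A0 G0 Gn0 AG GA.
case: d => [|d] in dH dmin G NG GN Gn0 AG GA G0 Gpos *.
  have HG : H = G by rewrite /G mul1r.
  have HH : H *m H = h.[1] *: H.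
    (* Modulo [X - 1], [h] is the constant [h(1)], and [N * H = 0]. *)
    have [q qE] : exists q, h - h.[1]%:P = q * ('X - 1%:P).
      by apply/factor_theorem; rewrite rootE !hornerE subrr.
    have -> : H *m H = (horner_mx A q * N + h.[1]%:M) * H.
      congr (_ * _); rewrite /H -(subrK h.[1]%:P h) qE rmorphD rmorphM rmorphB /=.
      by rewrite !hornerE subrr mulr0 add0r horner_mx_X !horner_mx_C.
    by rewrite mulrDl -mulrA {1}HG NG mulr0 add0r -mul_scalar_mx.
  have := mxtrace_pos_quasi_idempotent H h.[1]; rewrite {1}HG => /(_ Gpos HH).
  rewrite trH => /eqP; rewrite -subr_eq0 -{2}[h.[1]]mul1r -mulrBl mulf_eq0.
  by rewrite (gt_eqF h1) orbF subr_eq0 pnatr_eq1 => /eqP->.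
(* [G] now has a factor [N], which commutes past [H] to meet the second [G], and [N * G = 0]; but
   [G * G] is positive. *)
have : (G * G) 0 0 = 0.
  rewrite {1}/G exprSr -!mulrA (mulrA N) -(hN h : H * N = N * H).
  by rewrite -!mulrA NG !mulr0 mxE.
move/eqP; rewrite mxE gt_eqF // (bigD1 0) //= ltr_pwDl ?mulr_gt0 ?sumr_ge0 // => m _.
by rewrite mulr_ge0.
Qed.

(** * Induction over diagonal blocks *)

Lemma dvdp_prod_XsubC_mask {F : fieldType} (p : {poly F}) (s : seq F) :
  p \is monic -> p %| \prod_(x <- s) ('X - x%:P) ->
  exists m, p = \prod_(x <- mask m s) ('X - x%:P).
Proof.
move=> pm /dvdp_prod_XsubC[m pE]; exists m; apply/eqP.
by rewrite -eqp_monic // monic_prod_XsubC.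
Qed.

(** Strong induction on the dimension: both counts add over the two blocks of a reducible matrix.
    The condition on [q] excludes an irreducible block with spectrum one 1 and [q] copies of [y],
    whose trace must be 0. *)
Lemma zero_diag_count_le {R : realType} (x y : R) :
  x <= 0 -> y <= 0 -> (forall q : nat, 1 + y *+ q != 0) ->
  forall (n : nat) (A : 'M[R]_n) (s : seq R),
    (forall i j, 0 <= A i j) -> (forall i, A i i = 0) ->
    char_poly A = \prod_(z <- s) ('X - z%:P) -> all (mem [:: 1; x; y]) s ->
  (count_mem 1%R s <= count_mem x s)%N.
Proof.
move=> x0 y0 yq; elim/ltn_ind=> n IH A s A0 dA chA sxy.
have [/existsP[S /and3P[Sn0 SnT /'forall_forallP SA]]|irr] := boolP
  [exists S : {set 'I_n}, [&& S != set0, S != setT &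
     [forall i, forall j, (i \in S) ==> (j \notin S) ==> (A i j == 0)]]].
  have chS := char_poly_reducible A S.
  have {}chS := chS (fun i j iS jS => eqP (implyP (implyP (SA i j) iS) jS)).
  have block (T : {set 'I_n}) : T != setT ->
      char_poly (principal_mx T A) %| char_poly A ->
      exists s', [/\ char_poly (principal_mx T A) = \prod_(z <- s') ('X - z%:P)
                  & (count_mem 1%R s' <= count_mem x s')%N].
    (* The spectrum of a block is a subsequence of [s], hence still within [1], [x], [y]. *)
    move=> TnT; rewrite chA => /(dvdp_prod_XsubC_mask _ _ (char_poly_monic _)).
    case=> m mE; exists (mask m s); split=> //.
    apply: (IH #|T| _ (principal_mx T A)) => //.
    - by rewrite -[n in (_ < n)%N]card_ord -cardsT proper_card // properT.
    - by move=> i j; rewrite mxE.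
    - by move=> i; rewrite mxE.
    - by apply/allP=> z /mem_mask; apply/allP.
  have [|s1 [ch1 c1]] := block S SnT; first by rewrite chS dvdp_mulr.
  have [||s2 [ch2 c2]] := block (~: S).
  - by apply: contraNneq Sn0 => SC; rewrite -(setCK S) SC setCT.
  - by rewrite chS dvdp_mull.
  have /prod_XsubC_eq/seq.permP sE : \prod_(z <- s) ('X - z%:P) =
      \prod_(z <- s1 ++ s2) ('X - z%:P).
    by rewrite big_cat /= -ch1 -ch2 -chS.
  by rewrite !sE !count_cat leq_add.
case: n => [|n] in A A0 dA chA irr {IH} *.
  have := congr1 (fun p : {poly R} => size p) chA.
  by rewrite size_char_poly size_prod_XsubC => -[]; case: (s).
pose t := [seq z <- s | z != 1]; pose c := count_mem 1%R s.
have sE : perm_eq s (nseq c 1 ++ t).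
  rewrite -(perm_filterC (pred1 1)) perm_cat2r.
  by have /all_pred1P-> := filter_all (pred1 1) s; rewrite size_filter.
have tP z : z \in t -> z = x \/ z = y.
  rewrite mem_filter => /andP[z1 /(allP sxy)].
  by rewrite !inE (negPf z1) /= => /orP[] /eqP->; [left|right].
have c1 : (c <= 1)%N.
  apply: (@irreducible_mult_le1 _ _ A c t) => //.
  - move=> S Sn0 SnT; move: irr; rewrite negb_exists => /forallP/(_ S).
    rewrite Sn0 SnT /= => /forallPn[i /forallPn[j]].
    by rewrite !negb_imply => /and3P[iS jS Aij]; exists i, j.
  - by apply/allP=> z /tP[]->.
  - by rewrite chA (perm_big _ sE).
rewrite -/c; case: c c1 sE => [|[|//]] _ sE //.
rewrite lt0n; apply/negP=> xs0.
(* Without [x], everything besides the single 1 is [y], and the zero trace contradicts [yq]. *)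
have ty : t = nseq (size t) y.
  apply/all_pred1P/allP=> z zt; have [zx|-> /=] := tP z zt; last exact: eqxx.
  move: xs0; rewrite -leqn0 leqNgt -has_count => /hasP[]; exists z; last by rewrite /= zx.
  by move: zt; rewrite mem_filter => /andP[].
have := mxtrace_horner A s 'X chA; rewrite horner_mx_X /mxtrace big1 => [|i _]; last exact: dA.
rewrite (perm_big _ sE) /= big_cons ty big_nseq iter_addr_0 !hornerX => /esym/eqP.
exact/negP.
Qed.

(** * Application to [sigma] *)

Lemma zero_diag_of_spectrum {R : rcfType} {n : nat} (A : 'M[R]_n) (s : seq R) :
  (forall i j, 0 <= A i j) -> char_poly A = \prod_(z <- s) ('X - z%:P) ->
  \sum_(z <- s) z = 0 -> forall i, A i i = 0.
Proof.
case: n A => [|n] A A0 chA s0 i; first by case: i.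
have := mxtrace_horner A s 'X chA; rewrite horner_mx_X.
under [in RHS]eq_bigr do rewrite hornerX.
rewrite s0 => /eqP; rewrite psumr_eq0 // => /allP/(_ i).
by rewrite mem_index_enum => /(_ isT)/eqP.
Qed.

Theorem theorem3 (R : realType) (k : nat) (hk : (2 <= k)%N) :
  size (sigma R k) = (2 * k.+1)%N /\
  \sum_(l <- sigma R k) l = 0 /\ ~ realizable (sigma R k).
Proof.
pose x : R := - 1 / (2 * k%:R + 1); pose y : R := (1 - 2 * k%:R) / (2 * k%:R + 1).
pose s := nseq k 1 ++ x :: nseq k.+1 y.
have k2 : (2 : R) <= k%:R by rewrite ler_nat.
have den0 : (0 : R) < 2 * k%:R + 1 by lra.
have sigmaE : sigma R k = [seq z%:C%C | z <- s].
  by rewrite map_cat /= !map_nseq.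
have s0 : \sum_(z <- s) z = 0.
  rewrite big_cat big_cons !big_nseq !iter_addr_0 /= -[y *+ k.+1]mulr_natr.
  by rewrite /x /y -natr1; field; rewrite gt_eqF.
split; first by rewrite !size_cat /= !size_nseq; lia.
split; first by rewrite sigmaE big_map -(rmorph_sum (real_complex R)) s0.
case=> A [A0 chA].
(* All prescribed eigenvalues are real, so the factorization descends from [R[i]] to [R]. *)
have {}chA : char_poly A = \prod_(z <- s) ('X - z%:P).
  apply: (map_poly_inj (real_complex R)); rewrite [LHS]chA sigmaE big_map rmorph_prod.
  by apply: eq_bigr => z _; rewrite /= rmorphB /= map_polyX map_polyC.
have x0 : x <= 0 by rewrite /x ler_pdivrMr // mul0r; lra.
have y0 : y <= 0 by rewrite /y ler_pdivrMr // mul0r; lra.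
have yx : y < x by rewrite /x /y ltr_pM2r ?invr_gt0 //; lra.
(* Clearing denominators gives [2k + 1 + q = 2kq] in the naturals: [q <= 1] fails at once, and for
   [q >= 2] the right side is larger since [k >= 2]. *)
have yq q : 1 + y *+ q != 0.
  apply/eqP=> e.
  have : (2 * k + 1 + q)%:R = (q * (2 * k))%:R :> R.
    apply/eqP; rewrite -subr_eq0 -[X in _ == X](mulr0 (2 * k%:R + 1)) -e.
    rewrite /y -mulr_natr !natrD !natrM; apply/eqP; field.
    by rewrite gt_eqF.
  move/eqP; rewrite eqr_nat => /eqP; case: q {e} => [|[|q]]; nia.
have sxy : all (mem [:: 1; x; y]) s.
  by rewrite all_cat /= !all_nseq /= !inE !eqxx !orbT.
have := zero_diag_count_le _ _ x0 y0 yq _ A s A0 (zero_diag_of_spectrum _ _ A0 chA s0) chA sxy.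
(* [x] differs from 1 and [y], so it occurs once, while 1 occurs at least [k] times. *)
rewrite /s !count_cat /= !count_nseq /= !eqxx mul1n (lt_eqF yx).
have -> : (1 == x) = false by apply/gt_eqF; lra.
by move=> /(leq_trans (leq_addr _ _)); rewrite leqNgt hk.
Qed.
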